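(* For every $\vec{s}\in S$ and every $\varepsilon>0$, there is a 4-regular graph gadget with signature $\vec{s}'$ such that $\|\vec{s}-\vec{s}'\|_1\le\varepsilon$.
   Context: The set $S\subseteq\mathbb{R}^3$ consists of all vectors $P(\alpha,\beta,\gamma)^{\mathrm T}$, where $P$ is a $3\times3$ permutation matrix, $\alpha\ge\beta\ge\gamma\ge0$, $\alpha+\beta+\gamma=1$, and $\gamma\ge f(\beta)$, where $f(x)=\frac12(1-x)\bigl(1-\exp(2x/(x-1))\bigr)$. A 4-regular graph gadget is a finite undirected graph (parallel edges and loops allowed) together with exactly four half-edges, labelled $0,1,2,3$, each incident with exactly one vertex, such that every vertex has degree 4 (counting half-edges, and loops twice). A route is a trail (no repeated edges, repeated vertices allowed) starting with one half-edge and ending with another. A valid set of routes is a set of two routes such that every edge and every half-edge is travelled exactly once (routes are considered up to reversal); equivalently, it is a choice at every vertex of a perfect matching of the four edge-ends/half-edges at it such that following the matchings yields two trails joining the four half-edges in pairs and no closed trails. $\mathrm{VR}(\{a,b\},\{c,d\})$ denotes the set of valid sets of routes in which one route connects half-edges $a,b$ and the other connects $c,d$. The signature of a gadget is the triple $(\alpha,\beta,\gamma)$ with $\alpha=|\mathrm{VR}(\{0,1\},\{2,3\})|/N$, $\beta=|\mathrm{VR}(\{0,2\},\{1,3\})|/N$, $\gamma=|\mathrm{VR}(\{0,3\},\{1,2\})|/N$, where $N$ is the sum of the three cardinalities (defined when $N>0$). *)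

(* Defs.v *)
From HB Require Import structures.
From mathcomp Require Import all_boot all_order all_fingroup all_algebra.
From mathcomp Require Import all_classical all_reals all_analysis.
Set Implicit Arguments.
Unset Strict Implicit.
Unset Printing Implicit Defensive.
Import Order.TTheory GRing.Theory Num.Theory.
Local Open Scope ring_scope.

(* An edge [e] has the two ends [inl (e, false)] and [inl (e, true)]; the
   half-edge labelled [i] is the end [inr i].  A loop is an edge with both ends
   at the same vertex, hence it counts twice in the degree. *)
Definition edge_end (E : finType) : finType := ((E * bool) + 'I_4)%type.

Record gadget := Gadget {
  vertex : finType;
  edge : finType;
  end_at : edge_end edge -> vertex;
  gadget_regular : forall v : vertex, #|[set x | end_at x == v]| = 4%N
}.

Section Routes.
Variable G : gadget.
Let D := edge_end (edge G).

Definition other_end (x : D) : D :=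
  match x with
  | inl (e, b) => inl (e, ~~ b)
  | inr i => inr i
  end.

(* A perfect matching of the ends at each vertex, given for all vertices at
   once as an involution [M] without fixed points that preserves vertices. *)
Definition matching_system (M : {ffun D -> D}) : bool :=
  [forall x, [&& M (M x) == x, M x != x & end_at (M x) == end_at x]].

(* Each end is adjacent to its match and, unless it is a half-edge, to the other
   end of its edge; so the connected components are the trails obtained by
   following [M]: a closed trail contains no half-edge, any other trail contains
   exactly the two half-edges that it joins. *)
Definition same_trail (M : {ffun D -> D}) : rel D :=
  connect [rel x y | (y == M x) || (y == other_end x)].

(* Each valid set of two routes, one joining [a] and [b], the other joining [c]
   and [d], is represented by its matching system.  The last condition excludes
   closed trails. *)
Definition VR (a b c d : 'I_4) : {set {ffun D -> D}} :=
  [set M | [&& matching_system M,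
               same_trail M (inr a) (inr b),
               same_trail M (inr c) (inr d),
               ~~ same_trail M (inr a) (inr c)
             & [forall x, same_trail M (inr a) x || same_trail M (inr c) x]]].

Definition num_valid : nat :=
  (#|VR 0%R 1%R 2%R 3%R| + #|VR 0%R 2%R 1%R 3%R| + #|VR 0%R 3%R 1%R 2%R|)%N.

End Routes.

Section Signatures.
Variable R : realType.

Definition col3 (a b c : R) : 'cV[R]_3 := \col_i [:: a; b; c]`_i.

(* Meaningful only when [0 < num_valid G]. *)
Definition signature (G : gadget) : 'cV[R]_3 :=
  col3 (#|VR G 0 1 2 3|%:R / (num_valid G)%:R)
       (#|VR G 0 2 1 3|%:R / (num_valid G)%:R)
       (#|VR G 0 3 1 2|%:R / (num_valid G)%:R).

Definition gamma_min (x : R) : R :=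
  2^-1 * (1 - x) * (1 - expR (2 * x / (x - 1))).

Definition sig_region : set 'cV[R]_3 :=
  [set s | exists (sigma : 'S_3) (alpha beta gamma : R),
    [/\ alpha >= beta /\ beta >= gamma, gamma >= 0, alpha + beta + gamma = 1,
        gamma >= gamma_min beta
      & s = perm_mx sigma *m col3 alpha beta gamma]]%classic.

Definition l1_norm (v : 'cV[R]_3) : R := \sum_i `|v i 0|.

End Signatures.

(* Main.v *)
Require Import Defs.
From mathcomp Require Import all_boot all_order all_fingroup all_algebra.
From mathcomp Require Import all_classical all_reals all_analysis.
From mathcomp Require Import ring lra.
Import Order.TTheory GRing.Theory Num.Theory.
Local Open Scope ring_scope.

(** Let a gadget have (a, b, c) valid sets of routes of the three types.  Gluing
    the half-edges 2, 3 of one gadget to 0, 1 of another adds the quantities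
    x = a / (b + c) and multiplies the quantities t = (b - c) / (b + c), while
    relabelling half-edges permutes (a, b, c); a single vertex has (1, 1, 1).
    Chains of vertices have (x, t) = (n / 2, 0), which after relabelling becomes
    (1 / (n + 1), 1 - 2 / (n + 1)); chains of these approach all the points
    (x, e^(-2x)).  Gluing a vertex to them and relabelling gives (y, 1 - 2y) for
    0 <= y <= 1/2.  The points (y, 1 - 2y) and (x - y, e^(-2(x - y))) together
    give (x, (1 - 2y) e^(-2(x - y))), and letting y vary covers the region,
    which in these coordinates is t <= e^(-2x).  *)

Set Implicit Arguments.
Unset Strict Implicit.
Unset Printing Implicit Defensive.

(** * Parity and the trails of two involutions *)

Lemma fpf_involution_even (T : finType) (f : T -> T) (A : {set T}) :
  {in A, forall x, [/\ f x \in A, f x != x & f (f x) = x]} -> ~~ odd #|A|.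
Proof.
(* Strong induction on a bound [n] of the cardinality, removing one pair [x], [f x] at a time. *)
move: {2}#|A| (leqnn #|A|) => n; elim: n A => [|n IHn] A.
  by rewrite leqn0 => /eqP->.
have [->|[x xA]] := set_0Vmem A; first by rewrite cards0.
move=> leAn fA; have [fxA fxx ffx] := fA x xA.
have cA : #|A| = #|A :\ x :\ f x|.+2.
  by rewrite (cardsD1 x) xA (cardsD1 (f x) (A :\ x)) !inE fxx fxA.
rewrite cA /= negbK; apply: IHn => [|y]; first by rewrite cA in leAn; apply: ltnW.
rewrite !inE => /and3P[yfx yx yA]; have [fyA fyy ffy] := fA y yA.
rewrite fyA !andbT; split=> //; apply/andP; split.
  by apply: contra yx => /eqP e; rewrite -ffy e ffx.
by apply: contra yfx => /eqP e; rewrite -ffy e.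
Qed.

Section TwoInvolutions.
Variables (T : finType) (M o : T -> T).
Hypotheses (MK : involutive M) (oK : involutive o).

(** [same_trail] for abstract involutions: [M] stands for the matching at the vertices, [o] for
    passing to the other end of an edge. The fixed points of [o] play the role of the half-edges. *)
Definition trail : rel T := connect [rel x y | (y == M x) || (y == o x)].

Lemma trail_refl x : trail x x. Proof. exact: connect0. Qed.

Lemma trail_trans : transitive trail. Proof. exact: connect_trans. Qed.

Lemma trail_sym : symmetric trail.
Proof.
apply: sym_connect_sym => x y /=.
by rewrite -[x == M y](can2_eq MK MK) -[x == o y](can2_eq oK oK) !(eq_sym y).
Qed.

Lemma trail_M x : trail x (M x). Proof. by apply: connect1; rewrite /= eqxx. Qed.

Lemma trail_o x : trail x (o x).
Proof. by apply: connect1; rewrite /= eqxx orbT. Qed.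

Lemma trail_ind (P : pred T) :
    (forall x, P x -> P (M x)) -> (forall x, P x -> P (o x)) ->
  forall x y, trail x y -> P x -> P y.
Proof.
move=> PM Po x y /connectP[p]; elim: p x => [|z p IHp] x /=; first by move=> _ ->.
by case/andP=> /orP[]/eqP-> /IHp{}IHp /IHp{}IHp Px; apply: IHp; auto.
Qed.

Let p x := o (M x).

Let p_inj : injective p.
Proof. by move=> x y /(inv_inj oK)/(inv_inj MK). Qed.

(** Conjugation by [o] inverts [p], as in a dihedral group. *)
Let iter_p_o k x : iter k p (o (iter k p x)) = o x.
Proof.
elim: k x => //= k IHk x; rewrite -iterS iterSr /p oK MK; exact: IHk.
Qed.

(* [o (M x)] rotates the trail of a fixed point [a] of [o], and [o] reflects it
   about [a]; the reflection fixes at most one more point. *)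
Lemma trail_fixed a b :
  o a = a -> o b = b -> trail a b -> b != a ->
  b = iter (fingraph.order p a)./2 p a.
Proof.
move=> oa ob ab ba.
(* The trail of [a] is a single orbit of [p]: the orbit is stable under [o] because [o] fixes [a],
   and [M x] is [o (p x)]. *)
have {ab} : fconnect p a b.
  have psym := fconnect_sym p_inj.
  have stabo x : fconnect p a x -> fconnect p a (o x).
    move=> ax; rewrite psym -(iter_findex ax).
    by rewrite -{3}oa -(iter_p_o (findex p a x) a) fconnect_iter.
  apply: (trail_ind (P := fconnect p a)) ab (connect0 _ _) => // x ax.
  by rewrite -[M x]oK; apply/stabo/(connect_trans ax)/fconnect1.
move=> ab; have kn := findex_max ab; have kb := iter_findex ab.
set k := findex p a b in kn kb; set n := fingraph.order p a in kn *.
(* As [o] fixes both [a] and [b], iterating [p] exactly [2 k] times fixes [a]; with [0 < k < n] this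
   forces [n = 2 k]. *)
have k2 : iter (k + k) p a = a by rewrite iterD kb -{1}ob -kb iter_p_o oa.
have [lt|ge] := ltnP (k + k) n.
  have := findex_iter lt; rewrite k2 findex0 => /esym/eqP.
  by rewrite addn_eq0 andbb => /eqP k0; rewrite -kb k0 /= eqxx in ba.
have lt : (k + k - n < n)%N by rewrite ltn_subLR // -addSn leq_add // ltnW.
have kna : iter (k + k - n) p a = a.
  by rewrite -{2}k2 -{2}(subnK ge) iterD iter_order.
have := findex_iter lt; rewrite kna findex0 => /esym/eqP; rewrite subn_eq0 => le.
have -> : n = k.*2 by apply/eqP; rewrite eqn_leq -addnn ge.
by rewrite doubleK kb.
Qed.

(** The position found in [trail_fixed] depends on [a] only. *)
Lemma trail_fixed_unique a b c :
  o a = a -> o b = b -> o c = c -> trail a b -> trail a c ->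
  b != a -> c != a -> b = c.
Proof.
by move=> oa ob oc ab ac /(trail_fixed oa ob ab)-> /(trail_fixed oa oc ac)->.
Qed.

(** Parity: [M] pairs off the trail of [a]. Were [a] the only fixed point of [o] on it, [o] would
    pair off the trail without [a], and both cardinalities would be even. *)
Lemma trail_fixed_exists a :
  (forall x, M x != x) -> o a = a -> exists b, [/\ o b = b, b != a & trail a b].
Proof.
move=> Mfpf oa.
have [b /and3P[/eqP ob ba ab]|no_b] :=
  pickP [pred b | [&& o b == b, b != a & trail a b]]; first by exists b.
pose C := [set x | trail a x].
have evC : ~~ odd #|C|.
  apply: (@fpf_involution_even _ M) => x; rewrite !inE => ax.
  by split=> //; apply: trail_trans ax (trail_M x).
have /negP[] : ~~ odd #|C :\ a|.
  apply: (@fpf_involution_even _ o) => x; rewrite !inE => /andP[xa ax].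
  split=> //; first rewrite (trail_trans ax (trail_o x)) andbT.
    by apply: contra xa => /eqP e; rewrite -[x]oK e oa.
  by apply: contraFN (no_b x) => /= ->; rewrite xa ax.
by move: evC; rewrite (cardsD1 a C) inE trail_refl /= negbK.
Qed.

End TwoInvolutions.

(** * Route sets of abstract end systems *)

Lemma mem_uniq4 (a b c d e : 'I_4) : uniq [:: a; b; c; d] -> e \in [:: a; b; c; d].
Proof.
move=> u; have sub : {subset [:: a; b; c; d] <= enum 'I_4}.
  by move=> x _; rewrite mem_enum.
have [|_ ->] := uniq_min_size u sub; first by rewrite size_enum_ord.
by rewrite mem_enum.
Qed.

(* A gadget seen from its edge-ends: [mate] exchanges the two ends of an edge,
   and its fixed points are the half-edges. *)
Record end_system := EndSystem {
  point :> finType;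
  site : finType;
  at_site : point -> site;
  mate : point -> point;
  half : 'I_4 -> point;
  mateK : involutive mate;
  half_inj : injective half;
  mate_fixed : forall x, (mate x == x) = (x \in codom half);
  site_regular : forall v : site, #|[set x | at_site x == v]| = 4%N
}.

Section EndSystem.
Variable S : end_system.
Implicit Types (M : {ffun S -> S}) (a b c d : 'I_4).

Definition pairing M : bool :=
  [forall x, [&& M (M x) == x, M x != x & at_site (M x) == at_site x]].

(** No closed trails: every trail contains a half-edge. *)
Definition covered M : bool :=
  [forall x, [exists i, trail M (@mate S) (half S i) x]].

(** A type is recorded by the partner [k] of half-edge 0, since the remaining two half-edges are
    then joined as well. For [k = 0] the last condition is void, hence the hypotheses [k != 0]
    below. *)
Definition routes k : {set {ffun S -> S}} :=
  [set M | [&& pairing M, covered M & trail M (@mate S) (half S 0) (half S k)]].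

Lemma pairingP M :
  reflect [/\ involutive M, forall x, M x != x & forall x, at_site (M x) = at_site x]
          (pairing M).
Proof.
apply: (iffP forallP) => [MP|[MK Mfpf Msite] x]; last by rewrite MK Mfpf Msite !eqxx.
by split=> x; case/and3P: (MP x) => // /eqP // _ _ /eqP.
Qed.

Lemma mate_half a : mate (half S a) = half S a.
Proof. by apply/eqP; rewrite mate_fixed codom_f. Qed.

Lemma half_eq a b : (half S a == half S b) = (a == b).
Proof. exact: inj_eq (@half_inj S) _ _. Qed.

Section Pairing.
Variable M : {ffun S -> S}.
Hypothesis MP : pairing M.
Local Notation tr := (trail M (@mate S)).

Let MK : involutive M. Proof. by case/pairingP: MP. Qed.
Let oK := @mateK S.

Lemma half_partner_unique a b c :
  tr (half S a) (half S b) -> tr (half S a) (half S c) ->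
  b != a -> c != a -> b = c.
Proof.
move=> ab ac ba ca; apply: (@half_inj S).
by apply: (trail_fixed_unique MK oK) ab ac _ _; rewrite ?mate_half ?half_eq.
Qed.

Lemma half_partner a : exists2 b, b != a & tr (half S a) (half S b).
Proof.
have [_ Mfpf _] := pairingP M MP.
have [x []] := trail_fixed_exists MK oK Mfpf (mate_half a).
move=> /eqP; rewrite mate_fixed => /codomP[b ->]; rewrite half_eq => ba ab.
by exists b.
Qed.

(** By uniqueness of partners, the partner of [c] is neither [a] nor [b], so it is [d]. *)
Lemma half_complement a b c d :
  uniq [:: a; b; c; d] -> tr (half S a) (half S b) -> tr (half S c) (half S d).
Proof.
move=> u ab; have [e ec ce] := half_partner c.
have := mem_uniq4 e u; rewrite !inE (negPf ec) /=.
move: u; rewrite /= !inE !negb_or -!andbA => /and5P[nab nac nad nbc].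
move=> /and3P[nbd ncd _] /or3P[]/eqP e_; rewrite e_ in ec ce => //.
- have := half_partner_unique ab _ _ _; rewrite eq_sym in nab.
  by rewrite trail_sym // in ce => /(_ c ce nab); rewrite eq_sym nac => /(_ isT) /eqP; rewrite (negPf nbc).
rewrite trail_sym // in ab; rewrite trail_sym // in ce.
have := half_partner_unique ab ce nab; rewrite eq_sym nbc => /(_ isT) /eqP.
by rewrite (negPf nac).
Qed.

Lemma half_disjoint a b c :
  uniq [:: a; b; c] -> tr (half S a) (half S b) -> ~~ tr (half S a) (half S c).
Proof.
rewrite /= !inE !negb_or => /and3P[/andP[nab nac] nbc _] ab.
apply/negP => ac; have := half_partner_unique ab ac; rewrite !(eq_sym _ a) nab nac.
by move=> /(_ isT isT)/eqP; rewrite (negPf nbc).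
Qed.

End Pairing.

Lemma routes_unique M k l :
  M \in routes k -> M \in routes l -> k != 0 -> l != 0 -> k = l.
Proof.
rewrite !inE => /and3P[MP _ k0] /and3P[_ _ l0].
exact: half_partner_unique k0 l0.
Qed.

Lemma routes_exists M : pairing M -> covered M -> exists2 k, k != 0 & M \in routes k.
Proof.
move=> MP Mc; have [k k0 tk] := half_partner MP 0.
by exists k => //; rewrite inE MP Mc.
Qed.

Lemma disjoint_routes k l : k != l -> k != 0 -> l != 0 -> [disjoint routes k & routes l].
Proof.
move=> kl k0 l0; apply/pred0P => M /=; apply/negP => /andP[Mk Ml].
by rewrite (routes_unique Mk Ml) ?eqxx in kl.
Qed.

End EndSystem.

(** * Passing between gadgets and end systems *)

(** Conjugation by [phi] maps route sets injectively to route sets and keeps their type. Applied to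
    a bijection and to its inverse, this gives equality. *)
Lemma card_routes_le (S S' : end_system) (phi : S -> S') k :
    bijective phi -> {morph phi : x / mate x} ->
    (forall i, phi (half S i) = half S' i) ->
    (forall x y, at_site x = at_site y -> at_site (phi x) = at_site (phi y)) ->
  (#|routes S k| <= #|routes S' k|)%N.
Proof.
case=> psi phiK psiK phio phih phiv.
pose F (M : {ffun S -> S}) : {ffun S' -> S'} := [ffun x => phi (M (psi x))].
have Finj : injective F.
  move=> M N /ffunP MN; apply/ffunP => x; have := MN (phi x).
  by rewrite !ffunE phiK => /(can_inj phiK).
rewrite -(card_imset _ Finj); apply/subset_leq_card/fintype.subsetP => _ /imsetP[M MR ->].
have lift x y : trail M (@mate S) x y -> trail (F M) (@mate S') (phi x) (phi y).
  move=> xy; apply: (trail_ind (P := fun y => trail (F M) _ (phi x) (phi y))) xy (trail_refl _ _ _).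
    by move=> z xz; apply: trail_trans xz _; rewrite -{2}(phiK z) -[phi (M _)](ffunE (fun x => phi (M (psi x)))) trail_M.
  by move=> z xz; apply: trail_trans xz _; rewrite phio trail_o.
move: MR; rewrite !inE => /and3P[/pairingP[MK Mfpf Msite] /forallP Mc tk].
apply/and3P; split.
- apply/pairingP; split=> x; rewrite !ffunE ?phiK ?MK ?psiK //.
    by rewrite -{2}(psiK x) (inj_eq (can_inj phiK)).
  by rewrite -[in RHS](psiK x); apply: phiv.
- apply/forallP => x; have /existsP[i hi] := Mc (psi x); apply/existsP; exists i.
  by rewrite -phih -(psiK x) lift.
- by rewrite -!phih lift.
Qed.

Section Gadget.
Variable G : gadget.

Lemma other_endK : involutive (@other_end G).
Proof. by case=> [[e b]|i] //=; rewrite negbK. Qed.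

Lemma other_end_fixed (x : edge_end (edge G)) :
  (other_end x == x) = (x \in codom (inr : 'I_4 -> edge_end (edge G))).
Proof.
case: x => [[e b]|i] /=; last by rewrite eqxx codom_f.
transitivity false; first by apply/eqP => -[]; case: b.
by apply/esym/negP => /codomP[].
Qed.

Lemma half_end_inj : injective (inr : 'I_4 -> edge_end (edge G)).
Proof. by move=> i j []. Qed.

Definition gadget_ends : end_system :=
  @EndSystem (edge_end (edge G)) (vertex G) (@end_at G) (@other_end G) inr
    other_endK half_end_inj other_end_fixed (@gadget_regular G).

(** The trail from [c] to [d] follows from the one from 0 to [b], and the trail of any half-edge is
    one of these two. *)
Lemma VR_routes (b c d : 'I_4) :
  uniq [:: 0; b; c; d] -> VR G 0 b c d = routes gadget_ends b.
Proof.
move=> u; apply/setP => M; rewrite !inE.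
apply/and5P/and3P => [[MP tb _ _ /forallP Mc]|[MP /forallP Mc tb]].
  split=> //; apply/forallP => x; apply/existsP.
  by case/orP: (Mc x) => cx; [exists 0 | exists c].
have MK : involutive M by case/pairingP: MP.
have tcd := half_complement MP u tb.
split=> //.
  apply: (half_disjoint (S := gadget_ends) MP _ tb).
  by apply: subseq_uniq u; rewrite /= !eqxx.
apply/forallP => x; have /existsP[i] := Mc x.
have := mem_uniq4 i u; rewrite !inE => /or4P[]/eqP-> ix; apply/orP.
- by left.
- by left; apply: trail_trans tb ix.
- by right.
- by right; apply: trail_trans tcd ix.
Qed.

End Gadget.

Section Realize.
Variable S : end_system.

(** Edges are the two-element orbits of [mate], each represented by its end of smaller rank. *)
Definition edge_of : finType := {x : S | (enum_rank x < enum_rank (mate x))%N}.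

Definition point_of (x : edge_end edge_of) : S :=
  match x with
  | inl (e, b) => if b then mate (val e) else val e
  | inr i => half S i
  end.

Lemma point_of_bij : bijective point_of.
Proof.
have nfix (e : edge_of) : mate (val e) != val e.
  by apply: contraTneq (valP e) => ->; rewrite ltnn.
have nhalf (e : edge_of) i : val e != half S i /\ mate (val e) != half S i.
  split; first by apply: contraNneq (nfix e) => ->; rewrite mate_half.
  by apply: contraNneq (nfix e) => h; rewrite -{2}[val e]mateK h mate_half.
have nlt (e e' : edge_of) : mate (val e) != val e'.
  apply/eqP => ee'; have := valP e'; rewrite -ee' mateK => /(ltn_trans (valP e)).
  by rewrite ltnn.
have valI (e e' : edge_of) : val e = val e' -> e = e' by apply: val_inj.
have inj : injective point_of.
  move=> [[e b]|i] [[e' b']|j] /=; last by move/half_inj->.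
  - case: b b' => -[] ee'.
    + by rewrite (valI e e') //; apply: (can_inj (@mateK S)).
    + by case/eqP: (nlt e e').
    + by case/eqP: (nlt e' e); rewrite -ee'.
    + by rewrite (valI e e').
  - by have [/eqP h1 /eqP h2] := nhalf e j; case: b.
  - by have [/eqP h1 /eqP h2] := nhalf e' i; case: b' => /esym.
have sur y : exists x, point_of x = y.
  case: (ltngtP (enum_rank y) (enum_rank (mate y))) => [lt|gt|].
  - by exists (inl (Sub y lt : edge_of, false)).
  - have lt : (enum_rank (mate y) < enum_rank (mate (mate y)))%N by rewrite mateK.
    by exists (inl (Sub (mate y) lt : edge_of, true)); apply: mateK.
  - move/val_inj/enum_rank_inj/esym/eqP; rewrite mate_fixed => /codomP[i ->].
    by exists (inr i).
have surb y : exists x, point_of x == y by have [x <-] := sur y; exists x.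
exists (fun y => xchoose (surb y)) => y; first exact/inj/eqP/(xchooseP (surb _)).
exact/eqP/(xchooseP (surb _)).
Qed.

Lemma realize_regular (v : site S) :
  #|[set x | at_site (point_of x) == v]| = 4%N.
Proof.
rewrite -(site_regular v) -(card_imset _ (bij_inj point_of_bij)).
apply: eq_card => y; rewrite inE; have [g gK Kg] := point_of_bij.
apply/imsetP/idP => [[x]|yv]; first by rewrite inE => ? ->.
by exists (g y); rewrite ?inE Kg.
Qed.

Definition realize : gadget := Gadget realize_regular.

Lemma card_VR_realize (b c d : 'I_4) :
  uniq [:: 0; b; c; d] -> #|VR realize 0 b c d| = #|routes S b|.
Proof.
move=> u; rewrite VR_routes //; have [g gK Kg] := point_of_bij.
have mor : {morph point_of : x / other_end (G := realize) x >-> mate x}.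
  by case=> [[e []]|i] /=; rewrite ?mateK ?mate_half.
apply/anti_leq/andP; split.
  by apply: (@card_routes_le (gadget_ends realize) S point_of) => //; exists g.
apply: (@card_routes_le S (gadget_ends realize) g) => [|x|i|x y] /=.
- by exists point_of.
- by apply: (can_inj gK); rewrite Kg mor Kg.
- by apply: (can_inj gK); rewrite Kg.
- by rewrite !Kg.
Qed.

End Realize.

(** * Relabelling of half-edges, and the single vertex *)

Section Relabel.
Variables (S : end_system) (p : {perm 'I_4}).

Let half_p i := half S (p i).

Lemma relabel_inj : injective half_p.
Proof. exact: inj_comp (@half_inj S) (@perm_inj _ p). Qed.

Lemma relabel_fixed x : (mate x == x) = (x \in codom half_p).
Proof.
rewrite mate_fixed; apply/codomP/codomP => -[i ->]; last by exists (p i).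
by exists (p^-1%g i); rewrite /half_p permKV.
Qed.

Definition relabel : end_system :=
  EndSystem (@mateK S) relabel_inj relabel_fixed (@site_regular S).

(** Permutations fixing 0 keep the reference half-edge and already induce all permutations of the
    types 1, 2, 3. *)
Lemma routes_relabel k : p 0 = 0 -> routes relabel k = routes S (p k).
Proof.
move=> p0; apply/setP => M; rewrite !inE /= /half_p p0; congr [&& _, _ & _].
apply: eq_forallb => x; apply/existsP/existsP => -[i ix]; first by exists (p i).
by exists (p^-1%g i); rewrite /= /half_p permKV.
Qed.

End Relabel.

Section SingleVertex.

Lemma single_fixed (x : 'I_4) : (id x == x) = (x \in codom (@id 'I_4)).
Proof. by rewrite eqxx; apply/esym/codomP; exists x. Qed.

Lemma single_regular (v : unit) : #|[set x : 'I_4 | tt == v]| = 4%N.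
Proof. by case: v; rewrite eqxx cardsT card_ord. Qed.

(** Without edges the ends are the four half-edges, so [mate] is the identity. *)
Definition single : end_system :=
  @EndSystem 'I_4 unit (fun=> tt) id id (fun=> erefl) (@inj_id _)
    single_fixed single_regular.

Lemma card_routes_single (k c d : 'I_4) : uniq [:: 0; k; c; d] -> #|routes single k| = 1%N.
Proof.
move=> u; pose f (x : 'I_4) :=
  if x == 0 then k else if x == k then 0 else if x == c then d else c.
have := u; rewrite /= !inE !negb_or -!andbA => /and5P[n0k n0c n0d nkc].
move=> /and3P[nkd ncd _].
have ne := (eqxx, negPf n0k, negPf n0c, negPf n0d, negPf nkc, negPf nkd, negPf ncd,
  eq_sym k 0, eq_sym c 0, eq_sym d 0, eq_sym c k, eq_sym d k, eq_sym d c).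
have f0 : f 0 = k by rewrite /f eqxx.
have fk : f k = 0 by rewrite /f !ne.
have fc : f c = d by rewrite /f !ne.
have fd : f d = c by rewrite /f !ne.
suff -> : routes single k = [set finfun f] by rewrite cards1.
apply/setP => M; rewrite !inE; apply/and3P/eqP => [[MP _ t0k]|->].
  have [MK Mfpf _] := pairingP M MP.
  (* As [mate] is the identity, the trail of 0 consists of 0 and [M 0]. *)
  have M0 : M 0 = k.
    have : (k == 0) || (k == M 0).
      apply: (trail_ind (P := fun y => (y == 0) || (y == M 0))) t0k _ => //.
      by move=> x /orP[]/eqP->; rewrite ?MK eqxx ?orbT.
    by rewrite !ne => /eqP.
  have Mc : M c = d.
    have := mem_uniq4 (M c) u; rewrite !inE => /or4P[]/eqP // e.
    + by have := MK c; rewrite e M0 => /eqP; rewrite !ne.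
    + by have := MK c; rewrite e -M0 MK => /eqP; rewrite !ne.
    + by have := Mfpf c; rewrite e eqxx.
  apply/ffunP => x; rewrite ffunE.
  have := mem_uniq4 x u; rewrite !inE => /or4P[]/eqP->.
  + by rewrite f0.
  + by rewrite fk -M0 MK.
  + by rewrite fc.
  + by rewrite fd -Mc MK.
split.
- apply/pairingP; split=> x; rewrite !ffunE //.
    by have := mem_uniq4 x u; rewrite !inE => /or4P[]/eqP->; rewrite !(f0, fk, fc, fd).
  by have := mem_uniq4 x u; rewrite !inE => /or4P[]/eqP->; rewrite !(f0, fk, fc, fd) !ne.
- by apply/forallP => x; apply/existsP; exists x; apply: trail_refl.
- by have := trail_M (finfun f) (@mate single) 0; rewrite ffunE f0.
Qed.


End SingleVertex.

(** * Series composition of two end systems *)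

Lemma card_setXU (T1 T2 : finType) (A C : {set T1}) (B D : {set T2}) :
    [disjoint A & C] ->
  #|finset.setX A B :|: finset.setX C D| = (#|A| * #|B| + #|C| * #|D|)%N.
Proof.
move=> dAC; rewrite -!cardsX; apply/eqP; rewrite (leq_card_setU _ _).2.
apply/pred0P => -[x y] /=; rewrite !inE /=; apply/negP => /andP[/andP[xA _] /andP[xC _]].
by have /pred0P/(_ x) := dAC; rewrite /= xA xC.
Qed.

Lemma card_setU_disjoint (T : finType) (A B : {set T}) :
  [disjoint A & B] -> #|A :|: B| = (#|A| + #|B|)%N.
Proof. by move=> dAB; apply/eqP; rewrite (leq_card_setU _ _).2. Qed.

Section Series.
Variables S1 S2 : end_system.
Let D : finType := (S1 + S2)%type.

(* The half-edges 2 and 3 of [S1] are glued to 0 and 1 of [S2]. *)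
Definition series_mate (x : D) : D :=
  match x with
  | inl y => if y == half S1 2 then inr (half S2 0)
             else if y == half S1 3 then inr (half S2 1) else inl (mate y)
  | inr y => if y == half S2 0 then inl (half S1 2)
             else if y == half S2 1 then inl (half S1 3) else inr (mate y)
  end.

Definition series_half (i : 'I_4) : D :=
  if (i < 2)%N then inl (half S1 i) else inr (half S2 i).

Definition series_at (x : D) : site S1 + site S2 :=
  match x with inl y => inl (at_site y) | inr y => inr (at_site y) end.

Lemma mate_eq_half (S : end_system) (y : S) a : (mate y == half S a) = (y == half S a).
Proof. by rewrite (can2_eq (@mateK S) (@mateK S)) mate_half. Qed.

Lemma series_mateK : involutive series_mate.
Proof.
case=> y /=.
  have [->|y2] := eqVneq y (half S1 2); first by rewrite /= eqxx.
  have [->|y3] := eqVneq y (half S1 3); first by rewrite /= half_eq eqxx.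
  by rewrite /= !mate_eq_half (negPf y2) (negPf y3) mateK.
have [->|y0] := eqVneq y (half S2 0); first by rewrite /= eqxx.
have [->|y1] := eqVneq y (half S2 1); first by rewrite /= half_eq eqxx.
by rewrite /= !mate_eq_half (negPf y0) (negPf y1) mateK.
Qed.

Lemma series_half_inj : injective series_half.
Proof.
rewrite /series_half => i j.
by case: ifP => i2; case: ifP => j2 // [] /half_inj.
Qed.

Lemma series_fixed x : (series_mate x == x) = (x \in codom series_half).
Proof.
case: x => y /=.
  have [->|y2] := eqVneq y (half S1 2).
    apply/esym/codomP => -[i]; rewrite /series_half; case: ifP => // i2 [] /half_inj i_.
    by rewrite -i_ in i2.
  have [->|y3] := eqVneq y (half S1 3).
    apply/esym/codomP => -[i]; rewrite /series_half; case: ifP => // i2 [] /half_inj i_.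
    by rewrite -i_ in i2.
  transitivity (mate y == y) => //; rewrite mate_fixed.
  apply/codomP/codomP => -[i].
    move=> yi; exists i; rewrite /series_half yi; case: ifP => //.
    by case: i yi => [[|[|[|[|i]]]] lti] // yi _; move: y2 y3; rewrite yi !half_eq.
  by rewrite /series_half; case: ifP => // _ [->]; exists i.
have [->|y2] := eqVneq y (half S2 0).
  apply/esym/codomP => -[i]; rewrite /series_half; case: ifP => // i2 [] /half_inj i_.
  by rewrite -i_ in i2.
have [->|y3] := eqVneq y (half S2 1).
  apply/esym/codomP => -[i]; rewrite /series_half; case: ifP => // i2 [] /half_inj i_.
  by rewrite -i_ in i2.
transitivity (mate y == y) => //; rewrite mate_fixed.
apply/codomP/codomP => -[i].
  move=> yi; exists i; rewrite /series_half yi; case: ifP => //.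
  by case: i yi => [[|[|[|[|i]]]] lti] // yi _; move: y2 y3; rewrite yi !half_eq.
by rewrite /series_half; case: ifP => // _ [->]; exists i.
Qed.

Lemma series_regular v : #|[set x | series_at x == v]| = 4%N.
Proof.
case: v => v; rewrite -(site_regular v).
  rewrite -[RHS](card_imset _ (@inl_inj S1 S2)); apply: eq_card => -[] y; rewrite inE.
    by rewrite mem_imset ?inE //; apply: inl_inj.
  by apply/esym/imsetP => -[].
rewrite -[RHS](card_imset _ (@inr_inj S1 S2)); apply: eq_card => -[] y; rewrite inE.
  by apply/esym/imsetP => -[].
by rewrite mem_imset ?inE //; apply: inr_inj.
Qed.

Definition series : end_system :=
  EndSystem series_mateK series_half_inj series_fixed series_regular.

Definition sum_ffun (M : {ffun S1 -> S1} * {ffun S2 -> S2}) : {ffun series -> series} :=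
  [ffun x => match x with inl y => inl (M.1 y) | inr y => inr (M.2 y) end].

Lemma sum_ffun_inj : injective sum_ffun.
Proof.
move=> [M1 M2] [N1 N2] /ffunP MN; congr (_, _); apply/ffunP => x.
  by have := MN (inl x); rewrite !ffunE => -[].
by have := MN (inr x); rewrite !ffunE => -[].
Qed.

Lemma pairing_sum M : pairing (sum_ffun M) = pairing M.1 && pairing M.2.
Proof.
apply/forallP/andP => [MP|[/forallP P1 /forallP P2] [y|y]].
- by split; apply/forallP => y; [have := MP (inl y) | have := MP (inr y)]; rewrite /= !ffunE.
- by have := P1 y; rewrite /= !ffunE.
- by have := P2 y; rewrite /= !ffunE.
Qed.

(** A matching preserves sites and so never pairs ends of different factors; the default values [y]
    are never taken. *)
Lemma pairing_series (M : {ffun series -> series}) :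
  pairing M -> exists N, M = sum_ffun N.
Proof.
case/pairingP=> _ _ Msite.
exists ([ffun y => if M (inl y) is inl z then z else y],
        [ffun y => if M (inr y) is inr z then z else y]).
apply/ffunP => -[] y; rewrite !ffunE /=.
  by have := Msite (inl y); case: (M (inl y)).
by have := Msite (inr y); case: (M (inr y)).
Qed.

Section SeriesTrails.
Variables (M1 : {ffun S1 -> S1}) (M2 : {ffun S2 -> S2}).
Hypotheses (P1 : pairing M1) (P2 : pairing M2).
Let M := sum_ffun (M1, M2).
Local Notation tr1 := (trail M1 (@mate S1)).
Local Notation tr2 := (trail M2 (@mate S2)).
Local Notation tr := (trail M (@mate series)).
Let MP : pairing M. Proof. by rewrite pairing_sum P1. Qed.
Let M1K : involutive M1. Proof. by case/pairingP: P1. Qed.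
Let M2K : involutive M2. Proof. by case/pairingP: P2. Qed.
Let MK : involutive M. Proof. by case/pairingP: MP. Qed.
Let sym1 := trail_sym M1K (@mateK S1).
Let sym2 := trail_sym M2K (@mateK S2).
Let symM : symmetric tr. Proof. exact: trail_sym MK (@mateK series). Qed.
Let trans : transitive tr. Proof. exact: trail_trans. Qed.

Lemma series_glue0 : tr (inl (half S1 2)) (inr (half S2 0)).
Proof. by have := trail_o M (@mate series) (inl (half S1 2)); rewrite /= eqxx. Qed.

Lemma series_glue1 : tr (inl (half S1 3)) (inr (half S2 1)).
Proof.
by have := trail_o M (@mate series) (inl (half S1 3)); rewrite /= half_eq /= eqxx.
Qed.

(** The new [mate] differs from that of [S1] only at the glued half-edges, which the latter does not
    move. *)
Lemma series_trail_inl x y : tr1 x y -> tr (inl x) (inl y).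
Proof.
move=> xy; apply: (trail_ind (P := fun y => tr (inl x) (inl y))) xy (trail_refl _ _ _).
  move=> z xz; apply: trans xz _.
  by have := trail_M M (@mate series) (inl z); rewrite ffunE.
move=> z xz; have := trail_o M (@mate series) (inl z) => /=.
have [ze|_] := eqVneq z (half S1 2); first by rewrite ze mate_half -ze.
have [ze|_] := eqVneq z (half S1 3); first by rewrite ze mate_half -ze.
exact: trans xz.
Qed.

Lemma series_trail_inr x y : tr2 x y -> tr (inr x) (inr y).
Proof.
move=> xy; apply: (trail_ind (P := fun y => tr (inr x) (inr y))) xy (trail_refl _ _ _).
  move=> z xz; apply: trans xz _.
  by have := trail_M M (@mate series) (inr z); rewrite ffunE.
move=> z xz; have := trail_o M (@mate series) (inr z) => /=.
have [ze|_] := eqVneq z (half S2 0); first by rewrite ze mate_half -ze.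
have [ze|_] := eqVneq z (half S2 1); first by rewrite ze mate_half -ze.
exact: trans xz.
Qed.

(** A trail of [M1] without half-edges never meets the glue, so it remains closed in the
    composition. *)
Lemma series_covered_inl : covered M -> covered M1.
Proof.
move=> /forallP Mc; apply/forallP => x; apply: contraT => /existsPn no_half.
have nh i : ~~ tr1 x (half S1 i) by rewrite sym1.
have /existsP[i] := Mc (inl x); rewrite symM => xi.
pose P (z : series) := if z is inl y then tr1 x y else false.
have PM z : P z -> P (M z).
  by case: z => // y; rewrite ffunE => xy; apply: trail_trans xy (trail_M _ _ _).
have Pmate z : P z -> P (mate z).
  case: z => //= y xy; case: eqP xy => [->|_]; first by rewrite (negPf (nh _)).
  case: eqP => [->|_]; first by rewrite (negPf (nh _)).
  by move=> xy; apply: trail_trans xy (trail_o _ _ _).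
have := trail_ind PM Pmate xi (trail_refl _ _ _); rewrite /P /= /series_half.
by case: ifP => // _; rewrite (negPf (nh _)).
Qed.

Lemma series_covered_inr : covered M -> covered M2.
Proof.
move=> /forallP Mc; apply/forallP => x; apply: contraT => /existsPn no_half.
have nh i : ~~ tr2 x (half S2 i) by rewrite sym2.
have /existsP[i] := Mc (inr x); rewrite symM => xi.
pose P (z : series) := if z is inr y then tr2 x y else false.
have PM z : P z -> P (M z).
  by case: z => // y; rewrite ffunE => xy; apply: trail_trans xy (trail_M _ _ _).
have Pmate z : P z -> P (mate z).
  case: z => //= y xy; case: eqP xy => [->|_]; first by rewrite (negPf (nh _)).
  case: eqP => [->|_]; first by rewrite (negPf (nh _)).
  by move=> xy; apply: trail_trans xy (trail_o _ _ _).
have := trail_ind PM Pmate xi (trail_refl _ _ _); rewrite /P /= /series_half.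
by case: ifP => // _; rewrite (negPf (nh _)).
Qed.

(* Both trails that end at glued half-edges would close up. *)
Lemma series_not_covered :
  tr1 (half S1 0) (half S1 1) -> tr2 (half S2 0) (half S2 1) -> ~~ covered M.
Proof.
move=> t1 t2; apply/negP => /forallP /(_ (inl (half S1 2))) /existsP[i].
have t23 : tr1 (half S1 2) (half S1 3) by apply: (half_complement P1 _ t1).
rewrite symM => ti.
pose P (z : series) :=
  match z with inl y => tr1 (half S1 2) y | inr y => tr2 (half S2 0) y end.
have PM z : P z -> P (M z).
  by case: z => y; rewrite ffunE => xy; apply: trail_trans xy (trail_M _ _ _).
have Pmate z : P z -> P (mate z).
  case: z => /= y xy.
    case: eqP => _; first exact: trail_refl.
    case: eqP => _; first exact: t2.
    exact: trail_trans xy (trail_o _ _ _).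
  case: eqP => _; first exact: trail_refl.
  case: eqP => _; first exact: t23.
  exact: trail_trans xy (trail_o _ _ _).
have := trail_ind PM Pmate ti (trail_refl _ _ _); rewrite /P /=.
case: i {ti} => [[|[|[|[|i]]]] lti] //; rewrite /series_half /=; apply/negP.
- by apply: (half_disjoint P1 _ t23).
- by apply: (half_disjoint P1 _ t23).
- by apply: (half_disjoint P2 _ t2).
- by apply: (half_disjoint P2 _ t2).
Qed.

Lemma series_covered :
    covered M1 -> covered M2 ->
    ~~ (tr1 (half S1 0) (half S1 1) && tr2 (half S2 0) (half S2 1)) ->
  covered M.
Proof.
move=> /forallP c1 /forallP c2 n12.
pose out x := [exists i, tr (series_half i) x].
have outT x y : tr x y -> out x -> out y.
  by move=> xy /existsP[i ix]; apply/existsP; exists i; apply: trans ix xy.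
have out0 : out (inl (half S1 0)) by apply/existsP; exists 0; apply: trail_refl.
have out1 : out (inl (half S1 1)) by apply/existsP; exists 1; apply: trail_refl.
have out2 : out (inr (half S2 2)) by apply/existsP; exists 2; apply: trail_refl.
have out3 : out (inr (half S2 3)) by apply/existsP; exists 3; apply: trail_refl.
(* It suffices to lead the half-edges 2 and 3 of [S1] outside: gluing then takes care of 0 and 1 of
   [S2], and every other end lies on the trail of a half-edge. *)
suff: out (inl (half S1 2)) /\ out (inl (half S1 3)).
  case=> o2 o3.
  have o0 := outT _ _ series_glue0 o2; have o1 := outT _ _ series_glue1 o3.
  apply/forallP => -[x|x].
    have /existsP[i ix] := c1 x; apply: outT (series_trail_inl ix) _.
    have := @mem_uniq4 0 1 2 3 i isT; rewrite !inE => /or4P[]/eqP->//.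
  have /existsP[i ix] := c2 x; apply: outT (series_trail_inr ix) _.
  have := @mem_uniq4 0 1 2 3 i isT; rewrite !inE => /or4P[]/eqP->//.
(* If [M1] does not join 0 and 1, it does not join 2 and 3 either, so each of these is joined to 0
   or 1. In the other case [M2] joins each of 0 and 1 to 2 or 3. *)
case/nandP: n12 => n.
  have part i : i \in [:: 2; 3] -> out (inl (half S1 i)).
    move=> i23; have [j ji] := half_partner P1 i.
    have := @mem_uniq4 0 1 2 3 j isT; rewrite !inE => /or4P[]/eqP j_ tij.
    - by rewrite j_ sym1 in tij; apply: outT (series_trail_inl tij) out0.
    - by rewrite j_ sym1 in tij; apply: outT (series_trail_inl tij) out1.
    - move: i23 ji tij; rewrite j_ !inE => /orP[]/eqP-> // _ tij.
      by case/negP: n; apply: (half_complement P1 _ tij).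
    - move: i23 ji tij; rewrite j_ !inE => /orP[]/eqP-> // _ tij.
      by case/negP: n; apply: (half_complement P1 _ tij).
  by split; apply: part.
have part i : i \in [:: 0; 1] -> out (inr (half S2 i)).
  move=> i01; have [j ji] := half_partner P2 i.
  have := @mem_uniq4 0 1 2 3 j isT; rewrite !inE => /or4P[]/eqP j_ tij.
  - move: i01 ji tij; rewrite j_ !inE => /orP[]/eqP-> // _ tij.
    by case/negP: n; rewrite sym2.
  - move: i01 ji tij; rewrite j_ !inE => /orP[]/eqP-> // _ tij.
    by case/negP: n.
  - by rewrite j_ sym2 in tij; apply: outT (series_trail_inr tij) out2.
  - by rewrite j_ sym2 in tij; apply: outT (series_trail_inr tij) out3.
by split; [apply: outT (part 0 isT) | apply: outT (part 1 isT)] => //;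
  rewrite symM; [apply: series_glue0 | apply: series_glue1].
Qed.

End SeriesTrails.

(* Types [i] and [j] of the two factors, and the resulting type [k]; a route
   set of type [k] joins the half-edges 0 and [k]. *)
Definition series_table : seq ('I_4 * 'I_4 * 'I_4) :=
  [:: (1, 2, 1); (1, 3, 1); (2, 1, 1); (3, 1, 1);
      (2, 2, 2); (3, 3, 2); (2, 3, 3); (3, 2, 3)].

Lemma series_table_neq0 i j k :
  (i, j, k) \in series_table -> [/\ i != 0, j != 0 & k != 0].
Proof.
pose nz (t : 'I_4 * 'I_4 * 'I_4) := [&& t.1.1 != 0, t.1.2 != 0 & t.2 != 0].
by move=> ijk; have /and3P[] := allP (isT : all nz series_table) _ ijk.
Qed.

(** Each row of the table is verified by following the route from half-edge 0 through the glued
    half-edges. *)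
Lemma routes_series_mem i j k M :
    M.1 \in routes S1 i -> M.2 \in routes S2 j -> (i, j, k) \in series_table ->
  sum_ffun M \in routes series k.
Proof.
case: M => M1 M2 /=; rewrite [_ \in routes S1 _]inE [_ \in routes S2 _]inE.
move=> /and3P[P1 c1 t1] /and3P[P2 c2 t2] ijk.
have M1K : involutive M1 by case/pairingP: P1.
have M2K : involutive M2 by case/pairingP: P2.
have sym1 := trail_sym M1K (@mateK S1); have sym2 := trail_sym M2K (@mateK S2).
have MP : pairing (sum_ffun (M1, M2)) by rewrite pairing_sum P1.
have MK : involutive (sum_ffun (M1, M2)) by case/pairingP: MP.
have symM := trail_sym MK (@mateK series).
have trans := @trail_trans _ (sum_ffun (M1, M2)) (@mate series).
have inl_t := @series_trail_inl M1 M2; have inr_t := @series_trail_inr M1 M2.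
have g0 := series_glue0 M1 M2; have g1 := series_glue1 M1 M2.
have g0' := g0; rewrite symM in g0'; have g1' := g1; rewrite symM in g1'.
(* Only the pair of types 1, 1 would close a trail, and it is not in the table. *)
rewrite inE MP series_covered //=; last first.
  apply/negP => /andP[s1 s2].
  have [n1 n2 _] := series_table_neq0 ijk.
  have i1 := half_partner_unique P1 t1 s1 n1 isT.
  have j1 := half_partner_unique P2 t2 s2 n2 isT.
  by rewrite i1 j1 in ijk.
have c1' a b c d := @half_complement S1 M1 P1 a b c d.
have c2' a b c d := @half_complement S2 M2 P2 a b c d.
move: ijk; rewrite !inE => ijk.
repeat (case/orP: ijk => ijk).
all: case/eqP: ijk => ? ? ?; subst i j k.
all: rewrite /series_half /=.
- exact: inl_t.
- exact: inl_t.
(* The route passes through [S2] and comes back: 0 to 2 in [S1], 0 to 1 in [S2], then 3 to 1 in [S1]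
   by [half_complement]. *)
- apply: (trans _ _ _ (inl_t _ _ t1)); apply: (trans _ _ _ g0); apply: (trans _ _ _ (inr_t _ _ t2)).
  by apply: (trans _ _ _ g1'); apply: inl_t; apply: (c1' 0 2).
- apply: (trans _ _ _ (inl_t _ _ t1)); apply: (trans _ _ _ g1); rewrite sym2 in t2.
  apply: (trans _ _ _ (inr_t _ _ t2)).
  by apply: (trans _ _ _ g0'); apply: inl_t; apply: (c1' 0 3).
- by apply: (trans _ _ _ (inl_t _ _ t1)); apply: (trans _ _ _ g0); apply: inr_t.
- apply: (trans _ _ _ (inl_t _ _ t1)); apply: (trans _ _ _ g1); apply: inr_t.
  exact: (c2' 0 3).
- by apply: (trans _ _ _ (inl_t _ _ t1)); apply: (trans _ _ _ g0); apply: inr_t.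
- apply: (trans _ _ _ (inl_t _ _ t1)); apply: (trans _ _ _ g1); apply: inr_t.
  exact: (c2' 0 2).
Qed.

(** Restriction to the factors gives types [i] and [j], not both 1 since no trail is closed. The
    table has a row for each such pair, and its result is [k] because types are unique. *)
Lemma routes_series_split k M : k != 0 -> M \in routes series k ->
  exists N i j, [/\ M = sum_ffun N, N.1 \in routes S1 i, N.2 \in routes S2 j
                  & (i, j, k) \in series_table].
Proof.
move=> k0 Mk; have := Mk; rewrite inE => /and3P[MP Mc _].
have [[M1 M2] eM] := pairing_series MP; rewrite eM in Mk MP Mc *.
have := MP; rewrite pairing_sum /= => /andP[P1 P2].
have [i i0 Mi] := routes_exists P1 (series_covered_inl P1 P2 Mc).
have [j j0 Mj] := routes_exists P2 (series_covered_inr P1 P2 Mc).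
exists (M1, M2), i, j; split=> //.
have n11 : ~~ ((i == 1) && (j == 1)).
  apply/negP => /andP[/eqP i1 /eqP j1]; move: Mc; apply/negP.
  by apply: series_not_covered => //; [move: Mi | move: Mj];
    rewrite ?i1 ?j1 inE => /and3P[].
have [l] : exists l, (i, j, l) \in series_table.
  have := @mem_uniq4 0 1 2 3 i isT; have := @mem_uniq4 0 1 2 3 j isT.
  move: i0 j0 n11; clear; rewrite !inE.
  move=> i0 j0 n11 /or4P[]/eqP j_ /or4P[]/eqP i_; subst i j => //.
  - by exists 1. - by exists 1. - by exists 1. - by exists 2. - by exists 3.
  - by exists 1. - by exists 3. - by exists 2.
move=> ijl; have Ml := @routes_series_mem i j l (M1, M2) Mi Mj ijl.
have [_ _ l0] := series_table_neq0 ijl.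
by rewrite (routes_unique Mk Ml k0 l0).
Qed.

Lemma routes_seriesP k M : k != 0 ->
  reflect (exists N i j, [/\ M = sum_ffun N, N.1 \in routes S1 i, N.2 \in routes S2 j
                  & (i, j, k) \in series_table]) (M \in routes series k).
Proof.
move=> k0; apply: (iffP idP) => [|[N [i [j [-> Ni Nj ijk]]]]].
  exact: routes_series_split.
exact: routes_series_mem Ni Nj ijk.
Qed.

Let route_pairs k :=
  [set N | [exists i, exists j,
    [&& (i, j, k) \in series_table, N.1 \in routes S1 i & N.2 \in routes S2 j]]].

Let card_routes_pairs k : k != 0 -> #|routes series k| = #|route_pairs k|.
Proof.
move=> k0; rewrite -(card_imset _ sum_ffun_inj); apply: eq_card => M.
apply/(routes_seriesP _ k0)/imsetP => [[N [i [j [-> Ni Nj ijk]]]]|[N]].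
  exists N => //; rewrite inE; apply/existsP; exists i; apply/existsP; exists j.
  by rewrite ijk Ni.
rewrite inE => /existsP[i /existsP[j /and3P[ijk Ni Nj]]] ->.
by exists N, i, j.
Qed.

Let in_route_pairs k N : (N \in route_pairs k) =
  has (fun t => [&& t.2 == k, N.1 \in routes S1 t.1.1 & N.2 \in routes S2 t.1.2])
      series_table.
Proof.
rewrite inE; apply/existsP/hasP => [[i /existsP[j /and3P[ijk Ni Nj]]]|].
  by exists (i, j, k); rewrite //= eqxx Ni.
case=> -[[i j] l] ijl /and3P[/eqP/= e Ni Nj]; rewrite e in ijl.
by exists i; apply/existsP; exists j; rewrite ijl Ni.
Qed.

Lemma card_routes_series1 :
  #|routes series 1| = (#|routes S1 1%R| * (#|routes S2 2%R| + #|routes S2 3%R|) +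
                        (#|routes S1 2%R| + #|routes S1 3%R|) * #|routes S2 1%R|)%N.
Proof.
(* The pairs of type 1 form two disjoint rectangles: type 1 in [S1] with 2 or 3 in [S2], and 2 or 3
   in [S1] with 1 in [S2]. *)
rewrite -!card_setU_disjoint ?disjoint_routes // -card_setXU; last first.
  by rewrite -finset.setI_eq0 finset.setIUr finset.setU_eq0 !finset.setI_eq0 !disjoint_routes.
rewrite card_routes_pairs //; apply: eq_card => N.
by case: N => N1 N2; rewrite in_route_pairs finset.in_setU !finset.in_setX !finset.in_setU /=; rewrite andb_orr andb_orl !orbF -!orbA.
Qed.

Lemma card_routes_series2 :
  #|routes series 2| = (#|routes S1 2%R| * #|routes S2 2%R| +
                        #|routes S1 3%R| * #|routes S2 3%R|)%N.
Proof.
rewrite -card_setXU ?disjoint_routes // card_routes_pairs //; apply: eq_card => N.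
by case: N => N1 N2; rewrite in_route_pairs finset.in_setU !finset.in_setX /=; rewrite !orbF.
Qed.

Lemma card_routes_series3 :
  #|routes series 3| = (#|routes S1 2%R| * #|routes S2 3%R| +
                        #|routes S1 3%R| * #|routes S2 2%R|)%N.
Proof.
rewrite -card_setXU ?disjoint_routes // card_routes_pairs //; apply: eq_card => N.
by case: N => N1 N2; rewrite in_route_pairs finset.in_setU !finset.in_setX /=; rewrite !orbF.
Qed.

End Series.

(** * Operations on realizable triples of counts *)

Definition counts (a b c : nat) : Prop :=
  exists S, [/\ #|routes S 1| = a, #|routes S 2| = b & #|routes S 3| = c].

Lemma counts_single : counts 1 1 1.
Proof.
by exists single; rewrite (@card_routes_single 1 2 3) // (@card_routes_single 2 1 3) //
  (@card_routes_single 3 1 2).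
Qed.

Lemma counts_series a b c a' b' c' : counts a b c -> counts a' b' c' ->
  counts (a * (b' + c') + (b + c) * a') (b * b' + c * c') (b * c' + c * b').
Proof.
move=> [S [<- <- <-]] [S' [<- <- <-]]; exists (series S S').
by rewrite card_routes_series1 card_routes_series2 card_routes_series3.
Qed.

Lemma counts_swap12 a b c : counts a b c -> counts b a c.
Proof.
move=> [S [<- <- <-]]; exists (relabel S (tperm 1 2)).
by rewrite !routes_relabel ?tpermL ?tpermR ?tpermD.
Qed.

Lemma counts_swap23 a b c : counts a b c -> counts a c b.
Proof.
move=> [S [<- <- <-]]; exists (relabel S (tperm 2 3)).
by rewrite !routes_relabel ?tpermL ?tpermR ?tpermD.
Qed.

(** The two adjacent swaps generate the symmetric group on three elements. *)
Lemma counts_perm (sigma : 'S_3) (w : 'I_3 -> nat) :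
  counts (w 0) (w 1) (w 2) -> counts (w (sigma 0)) (w (sigma 1)) (w (sigma 2)).
Proof.
have I3 (i : 'I_3) : [\/ i = 0, i = 1 | i = 2].
  case: i => [[|[|[|i]]] lti] //; [constructor 1|constructor 2|constructor 3];
  exact: val_inj.
move=> w012; have sI := @perm_inj _ sigma.
have := I3 (sigma 0); have := I3 (sigma 1); have := I3 (sigma 2).
have n01 : sigma 0 != sigma 1 by rewrite (inj_eq sI).
have n02 : sigma 0 != sigma 2 by rewrite (inj_eq sI).
have n12 : sigma 1 != sigma 2 by rewrite (inj_eq sI).
move=> s2 s1 s0; move: n01 n02 n12.
case: s0 => ->; case: s1 => ->; case: s2 => -> // _ _ _.
- exact: counts_swap23.
- exact: counts_swap12.
- exact/counts_swap23/counts_swap12.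
- exact/counts_swap12/counts_swap23.
- exact/counts_swap12/counts_swap23/counts_swap12.
Qed.

Lemma counts_gadget a b c : counts a b c -> exists G : gadget,
  [/\ #|VR G 0 1 2 3| = a, #|VR G 0 2 1 3| = b & #|VR G 0 3 1 2| = c].
Proof. by case=> S [<- <- <-]; exists (realize S); rewrite !card_VR_realize. Qed.

(** * Points attained and approached in the coordinates [x] and [t] *)

Section Closure.
Import numFieldNormedType.Exports.
Local Open Scope classical_set_scope.
Local Open Scope ring_scope.
Variable R : realType.

(* Coordinates of [counts a b c] in which series composition adds the first
   and multiplies the second. *)
Definition attained (x t : R) : Prop := exists a b c : nat,
  [/\ counts a b c, (0 < b + c)%N, x = a%:R / (b + c)%:R
    & t = (b%:R - c%:R) / (b + c)%:R].

(** Under [counts_series] both [b + c] and [b - c] are multiplicative, and the new first count is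
    the numerator of the sum of the two fractions [x] and [x']. *)
Lemma attained_series x t x' t' :
  attained x t -> attained x' t' -> attained (x + x') (t * t').
Proof.
move=> [a [b [c [abc bc_gt0 -> ->]]]] [a' [b' [c' [abc' bc'_gt0 -> ->]]]].
have e : (b * b' + c * c' + (b * c' + c * b') = (b + c) * (b' + c'))%N by ring.
do 3 eexists; split; first exact: counts_series abc abc'.
- by rewrite e muln_gt0 bc_gt0.
- rewrite e !(natrM, natrD); field.
  by rewrite -!natrD !pnatr_eq0 -!lt0n bc_gt0 bc'_gt0.
- rewrite e !(natrM, natrD); field.
  by rewrite -!natrD !pnatr_eq0 -!lt0n bc_gt0 bc'_gt0.
Qed.

Lemma attained_half : attained 2^-1 0.
Proof.
exists 1, 1, 1; split=> //; first exact: counts_single.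
  by rewrite mul1r.
by rewrite subrr mul0r.
Qed.

(* Exchanges the first two counts; [x = a / 2b] becomes [b / (a + b)]. *)
Lemma attained_swap x : attained x 0 ->
  attained (1 + 2 * x)^-1 (1 - 2 * (1 + 2 * x)^-1).
Proof.
move=> [a [b [c [abc bc_gt0 -> /esym/eqP]]]].
rewrite mulf_eq0 invr_eq0 pnatr_eq0 (gtn_eqF bc_gt0) orbF subr_eq0 eqr_nat.
move=> /eqP bc; rewrite -{}bc addnn double_gt0 in abc bc_gt0 *.
have b0 : 0 < b%:R :> R by rewrite ltr0n.
have a0 : 0 <= a%:R :> R by [].
exists b, a, b; split; first exact: counts_swap12.
- by rewrite addn_gt0 bc_gt0 orbT.
- by rewrite -addnn !natrD; field; rewrite !lt0r_neq0 //; lra.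
- by rewrite -addnn !natrD; field; rewrite !lt0r_neq0 //; lra.
Qed.

Lemma attained_half_mul n : attained (n.+1%:R / 2) 0.
Proof.
elim: n => [|n IHn]; first by rewrite div1r; apply: attained_half.
have := attained_series IHn attained_half.
by rewrite mulr0 -[in n.+2](addn1 n.+1) natrD mulrDl div1r.
Qed.

(** The base point is a chain of [n + 1] vertices after the swap of the first two counts; [k + 1]
    copies of it are composed. *)
Lemma attained_power n k :
  attained (k.+1%:R / n.+2%:R) ((n%:R / n.+2%:R) ^+ k.+1).
Proof.
have base : attained (1 / n.+2%:R) (n%:R / n.+2%:R).
  have := attained_swap (attained_half_mul n).
  have n0 : 0 <= n%:R :> R by [].
  have -> : (1 + 2 * (n.+1%:R / 2))^-1 = 1 / n.+2%:R :> R.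
    by rewrite -(natr1 n.+1) -(natr1 n); field; rewrite ?lt0r_neq0 //; lra.
  suff -> : 1 - 2 * (1 / n.+2%:R) = n%:R / n.+2%:R :> R by [].
  by rewrite -(natr1 n.+1) -(natr1 n); field; rewrite ?lt0r_neq0 //; lra.
elim: k => [//|k IHk]; have := attained_series IHk base.
by rewrite -mulrDl natr1 -exprSr.
Qed.

Definition approached (x t : R) : Prop := exists u v : nat -> R,
  [/\ forall n, attained (u n) (v n), u n @[n --> \oo] --> x
    & v n @[n --> \oo] --> t].

Lemma approached_series x t x' t' :
  approached x t -> approached x' t' -> approached (x + x') (t * t').
Proof.
move=> [u [v [uv ux vt]]] [u' [v' [uv' ux' vt']]].
exists (fun n => u n + u' n), (fun n => v n * v' n); split.
- by move=> n; apply: attained_series.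
- exact: cvgD.
- exact: cvgM.
Qed.

Lemma approached_exp x : 0 <= x -> approached x (expR (- (2 * x))).
Proof.
(* About [x (n + 3)] copies are composed. The shift to [n + 3] makes the numerator [n + 1] positive,
   so that it can be inverted. *)
move=> x0; pose k n := Num.truncn (x * n.+3%:R).
exists (fun n => (k n).+1%:R / n.+3%:R), (fun n => (n.+1%:R / n.+3%:R) ^+ (k n).+1).
have n3 n : 0 < n.+3%:R :> R by [].
have ux : (k n).+1%:R / n.+3%:R @[n --> \oo] --> x.
  apply: (@squeeze_cvgr _ _ _ _ (fun=> x) (fun n => x + harmonic n)).
  - near=> n; have /andP[l u] := truncn_itv (mulr_ge0 x0 (ltW (n3 n))).
    rewrite ler_pdivlMr // (ltW u) /= ler_pdivrMr //.
    rewrite -natr1 mulrDl lerD // /harmonic /= ler_pdivlMl // mulr1 ler_nat.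
    by rewrite -addn2 leq_addr.
  - exact: cvg_cst.
  - by rewrite -[X in _ --> X]addr0; apply: cvgD; [apply: cvg_cst|apply: cvg_harmonic].
pose u n := (k n).+1%:R / n.+3%:R : R.
split=> // [n|]; first exact: attained_power.
(* The base [(n + 1) / (n + 3)] lies between [e^(-2 / (n + 1))] and [e^(-2 / (n + 3))], by
   [1 + y <= e^y] at [y = 2 / (n + 1)] and at [y = -2 / (n + 3)]. *)
apply: (@squeeze_cvgr _ _ _ _ (fun n => expR (- (2 * (u n * (1 + 2 * harmonic n)))))
  (fun n => expR (- (2 * u n)))).
- near=> n; rewrite -/(u n); have n0 : 0 <= n%:R :> R by [].
  apply/andP; split.
    have -> : - (2 * (u n * (1 + 2 * harmonic n))) =
              - (2 / n.+1%:R) * (k n).+1%:R :> R.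
      rewrite /u /harmonic /= -(natr1 n.+2) -(natr1 n.+1) -(natr1 n).
      by field; rewrite ?lt0r_neq0 //; lra.
    rewrite expRM_natr lerXn2r ?nnegrE ?expR_ge0 ?divr_ge0 //.
    rewrite expRN -[leRHS]invf_div lef_pV2 ?posrE ?expR_gt0 ?divr_gt0 //.
    apply: le_trans (expR_ge1Dx _); rewrite -(natr1 n.+2) -(natr1 n.+1) -(natr1 n).
    by rewrite le_eqVlt; apply/orP; left; apply/eqP; field; rewrite ?lt0r_neq0 //; lra.
  have -> : - (2 * u n) = - (2 / n.+3%:R) * (k n).+1%:R :> R by rewrite /u; ring.
  rewrite expRM_natr lerXn2r ?nnegrE ?expR_ge0 ?divr_ge0 //.
  apply: le_trans (expR_ge1Dx _); rewrite -(natr1 n.+2) -(natr1 n.+1) -(natr1 n).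
  by rewrite le_eqVlt; apply/orP; left; apply/eqP; field; rewrite ?lt0r_neq0 //; lra.
- apply: (continuous_cvg _ (@continuous_expR R _)); apply: cvgN.
  have -> : 2 * x = 2 * (x * (1 + 2 * 0)) by rewrite mulr0 addr0 mulr1.
  apply: cvgM; first exact: cvg_cst.
  apply: cvgM => //; apply: cvgD; first exact: cvg_cst.
  by apply: cvgM; [exact: cvg_cst|exact: cvg_harmonic].
- apply: (continuous_cvg _ (@continuous_expR R _)); apply: cvgN.
  by apply: cvgM => //; exact: cvg_cst.
Unshelve. all: by end_near.
Qed.

Lemma approached_segment y : 0 <= y -> y <= 2^-1 -> approached y (1 - 2 * y).
Proof.
rewrite le_eqVlt => /predU1P[<- _|y_gt0 y_le].
  (* At [y = 0] no inverse is available; the point (0, 1) is [approached_exp] at 0. *)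
  by have := approached_exp (lexx 0); rewrite mulr0 oppr0 expR0 addr0.
(* The swap sends [X] to [(1 + 2 X)^-1], which is [y] for [X = (y^-1 - 1) / 2]. Of this, [1 / 2]
   comes from a glued vertex, which forces [t = 0]; the rest is nonnegative as [y <= 1 / 2]. *)
have z0 : 0 <= (y^-1 - 1) / 2 - 2^-1.
  have : 2 <= y^-1 by rewrite -[leLHS]invrK lef_pV2 ?posrE // invr_gt0.
  lra.
have [u [v [uv uz _]]] := approached_exp z0.
pose w n := (1 + 2 * (u n + 2^-1))^-1.
have wy : w n @[n --> \oo] --> y.
  have ey : y = (1 + 2 * ((y^-1 - 1) / 2 - 2^-1 + 2^-1))^-1.
    by rewrite subrK mulrC divfK // addrC subrK invrK.
  rewrite [X in _ --> X]ey; apply: cvgV; first by rewrite gt_eqF //; lra.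
  apply: cvgD; first exact: cvg_cst.
  by apply: cvgM; [exact: cvg_cst|apply: cvgD => //; exact: cvg_cst].
exists w, (fun n => 1 - 2 * w n); split=> //.
  move=> n; apply: attained_swap.
  by have := attained_series (uv n) attained_half; rewrite mulr0.
by apply: cvgB; [exact: cvg_cst|apply: cvgM => //; exact: cvg_cst].
Qed.

Lemma approached_region x t :
  0 <= x -> 0 <= t -> 1 - 2 * x <= t -> t <= expR (- (2 * x)) -> approached x t.
Proof.
(* [g y] is the second coordinate of the composition of the points over [y] and [x - y]. It is
   [e^(-2x)] at 0, and [1 - 2 x] or 0 at [m], so it takes the value [t] in between. *)
move=> x0 t0 xt te; pose g y := (1 - 2 * y) * expR (- (2 * (x - y))) : R.
pose m := Num.min x 2^-1.
have m0 : 0 <= m by rewrite le_min x0 invr_ge0 ler0n.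
have g0 : g 0 = expR (- (2 * x)) by rewrite /g mulr0 !subr0 mul1r.
have gm : g m <= t.
  rewrite /g /m; have [x2|/ltW x2] := leP x 2^-1.
    by rewrite subrr mulr0 oppr0 expR0 mulr1.
  by rewrite mulfV ?pnatr_eq0 // subrr mul0r.
have gc : {within `[0, m], continuous g}.
  apply: continuous_subspaceT => y; apply: cvgM.
    by apply: cvgB; [exact: cvg_cst|apply: cvgM => //; exact: cvg_cst].
  apply: (continuous_cvg _ (@continuous_expR R _)); apply: cvgN.
  by apply: cvgM; [exact: cvg_cst|apply: cvgB => //; exact: cvg_cst].
have [|y] := IVT m0 gc (v := t).
  by rewrite ge_min gm orbT le_max g0 te.
rewrite in_itv /= le_min => /and3P[y0 yx y2] <-.
rewrite -[x in approached x](subrKC y).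
by apply: approached_series (approached_segment y0 y2) (approached_exp _); rewrite subr_ge0.
Qed.

End Closure.

(** * Approximation of signatures *)

Section Signature.
Import numFieldNormedType.Exports.
Local Open Scope classical_set_scope.
Local Open Scope ring_scope.
Variable R : realType.

Definition fractions (w : 'I_3 -> nat) : 'cV[R]_3 :=
  \col_i ((w i)%:R / (\sum_j w j)%:R).

(** The first two counts are exchanged so that the first count gives the middle entry of the
    signature, which is then [x / (1 + x)]. *)
Lemma fractions_attained (x t : R) : attained x t -> exists w : 'I_3 -> nat,
  [/\ counts (w 0) (w 1) (w 2), (0 < \sum_j w j)%N
    & fractions w = col3 ((1 + t) / (2 * (1 + x))) (x / (1 + x)) ((1 - t) / (2 * (1 + x)))].
Proof.
move=> [a [b [c [abc bc_gt0 -> ->]]]].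
exists (fun i : 'I_3 => nth 0%N [:: b; a; c] i).
have sum_w : (\sum_(j < 3) nth 0 [:: b; a; c] j)%N = (b + a + c)%N.
  by rewrite !big_ord_recl big_ord0 /= addn0 addnA.
split; first exact: counts_swap12.
  by rewrite sum_w addnAC addn_gt0 bc_gt0.
have bc : 0 < b%:R + c%:R :> R by rewrite -natrD ltr0n.
have a0 : 0 <= a%:R :> R by [].
apply/colP => i; rewrite !mxE sum_w !natrD.
case: i => [[|[|[|i]]] lti] //=; field; rewrite ?lt0r_neq0 //; lra.
Qed.

Lemma l1_norm3 (v : 'cV[R]_3) : l1_norm v = `|v 0 0| + `|v 1 0| + `|v 2 0|.
Proof.
rewrite /l1_norm !big_ord_recl big_ord0 addr0 addrA.
by congr (`|v _ _| + `|v _ _| + `|v _ _|); apply: val_inj.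
Qed.

Lemma l1_norm_perm (sigma : 'S_3) (v : 'cV[R]_3) : l1_norm (perm_mx sigma *m v) = l1_norm v.
Proof.
rewrite /l1_norm [RHS](reindex_inj (@perm_inj _ sigma)); apply: eq_bigr => i _.
by rewrite -row_permE mxE.
Qed.

(** The entries are continuous in [x] and [t] where [1 + x] is nonzero, so along the approaching
    sequence each comes within [eps / 3]. *)
Lemma fractions_approached (x t eps : R) : 0 <= x -> approached x t -> 0 < eps ->
  exists w : 'I_3 -> nat, [/\ counts (w 0) (w 1) (w 2), (0 < \sum_j w j)%N
    & l1_norm (col3 ((1 + t) / (2 * (1 + x))) (x / (1 + x)) ((1 - t) / (2 * (1 + x)))
               - fractions w) <= eps].
Proof.
move=> x0 [u [v [uv ux vt]]] eps0.
have x1 : 1 + x != 0 by rewrite gt_eqF //; lra.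
have cst (l : R) : l @[_ --> \oo] --> l by exact: cvg_cst.
have u1 : 1 + u n @[n --> \oo] --> 1 + x by apply: cvgD.
have u2 : 2 * (1 + u n) @[n --> \oo] --> 2 * (1 + x) by apply: cvgM.
have near_lim (f : nat -> R) l : f n @[n --> \oo] --> l ->
    \forall n \near \oo, `|l - f n| <= eps / 3.
  by move=> /cvgrPdist_le; apply; rewrite divr_gt0.
have c1 : (1 + v n) / (2 * (1 + u n)) @[n --> \oo] --> (1 + t) / (2 * (1 + x)).
  by apply: cvgM; [apply: cvgD|apply: cvgV => //; rewrite mulf_neq0].
have c2 : u n / (1 + u n) @[n --> \oo] --> x / (1 + x).
  by apply: cvgM => //; apply: cvgV.
have c3 : (1 - v n) / (2 * (1 + u n)) @[n --> \oo] --> (1 - t) / (2 * (1 + x)).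
  by apply: cvgM; [apply: cvgB|apply: cvgV => //; rewrite mulf_neq0].
have [n [d1 d2 d3]] : exists n,
   [/\ `|(1 + t) / (2 * (1 + x)) - (1 + v n) / (2 * (1 + u n))| <= eps / 3,
       `|x / (1 + x) - u n / (1 + u n)| <= eps / 3
     & `|(1 - t) / (2 * (1 + x)) - (1 - v n) / (2 * (1 + u n))| <= eps / 3].
  near \oo => n; exists n; split; near: n; exact: near_lim.
have [w [cw w0 ew]] := fractions_attained (uv n).
exists w; split=> //; rewrite l1_norm3 ew !mxE /=; lra.
Unshelve. all: by end_near.
Qed.

Lemma signature_fractions (w : 'I_3 -> nat) :
  counts (w 0) (w 1) (w 2) -> exists G : gadget,
    num_valid G = (\sum_j w j)%N /\ signature R G = fractions w.
Proof.
move=> /counts_gadget[G [G1 G2 G3]]; exists G.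
have nv : num_valid G = (\sum_j w j)%N.
  rewrite /num_valid G1 G2 G3 !big_ord_recl big_ord0 addn0 addnA.
  by congr (w _ + w _ + w _)%N; apply: val_inj.
split=> //; apply/colP => i; rewrite /signature G1 G2 G3 nv !mxE.
by case: i => [[|[|[|i]]] lti] //=; congr ((w _)%:R / _); apply: val_inj.
Qed.

End Signature.

Theorem theorem6 (R : realType) (s : 'cV[R]_3) (eps : R) :
  sig_region s -> 0 < eps ->
  exists G : gadget,
    (0 < num_valid G)%N /\ l1_norm (s - signature R G) <= eps.
Proof.
move=> [sigma [alpha [beta [gamma [[ab bc] c0 abc gmin ->]]]]] eps0.
have b1 : 0 < 1 - beta by lra.
(* Coordinates of the sorted signature, its middle entry in the role of the first count. *)
pose x := beta / (1 - beta); pose t := (alpha - gamma) / (1 - beta).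
have x0 : 0 <= x by rewrite divr_ge0; lra.
(* The bounds on [t] translate the hypotheses: [0 <= t] is [gamma <= alpha], [1 - 2 x <= t] is
   [gamma <= beta], and [t <= e^(-2x)] is the bound by [gamma_min]. *)
have xt : approached x t.
  apply: approached_region => //.
  - by rewrite divr_ge0; lra.
  - rewrite -subr_ge0 /x /t.
    have -> : (alpha - gamma) / (1 - beta) - (1 - 2 * (beta / (1 - beta))) =
       2 * (beta - gamma) / (1 - beta).
      have -> : alpha = 1 - beta - gamma by lra.
      by field; rewrite gt_eqF.
    by rewrite divr_ge0; lra.
  - move: gmin; rewrite /gamma_min.
    have -> : 2 * beta / (beta - 1) = - (2 * x) by rewrite /x -[beta - 1]opprB invrN mulrN mulrA.
    move=> gmin; rewrite ler_pdivrMr //; lra.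
have [w [cw w0 dw]] := fractions_approached x0 xt eps0.
(* The permutation of the entries is realized by permuting the counts, which leaves their sum and
   the distance unchanged. *)
have [G [nG sG]] := @signature_fractions R (fun i => w (sigma i)) (counts_perm sigma cw).
have sw : (\sum_j w (sigma j) = \sum_j w j)%N by rewrite [RHS](reindex_inj (@perm_inj _ sigma)).
exists G; rewrite nG sw; split=> //.
have -> : signature R G = perm_mx sigma *m fractions R w.
  by apply/colP => i; rewrite sG -row_permE !mxE sw.
rewrite -mulmxBr l1_norm_perm.
suff -> : col3 alpha beta gamma = col3 ((1 + t) / (2 * (1 + x))) (x / (1 + x)) ((1 - t) / (2 * (1 + x))) by [].
have n1 : 1 - beta != 0 by rewrite gt_eqF.
rewrite /t /x; have -> : alpha = 1 - beta - gamma by lra.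
apply/colP => i; rewrite !mxE.
by case: i => [[|[|[|i]]] lti] //=; field; rewrite n1 subrK oner_eq0.
Qed.
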